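(* Let $d\ge2$, $\ell\ge0$, $0<R_1<R_2$. Let $k^{(1)},k^{(2)}$ be two distinct resonant wavenumbers of the same mode $\ell$, and for $i=1,2$ put $A_i=\mathrm A_\ell(k^{(i)})$, $B_i=\mathrm B_\ell(k^{(i)})$, $C_i=\mathrm C_\ell(k^{(i)})$, $D_i=\mathrm D_\ell(k^{(i)})$ and $$p_0=C_1D_2-C_2D_1,\qquad p_1=A_1D_2-A_2D_1+B_2C_1-B_1C_2,\qquad p_2=A_1B_2-A_2B_1.$$ Assume the nondegeneracy conditions $$A_1\alpha_1+C_1\neq0,\qquad p_2^2+p_1^2+p_0^2\neq0.$$ Then every physical impedance pair $(\alpha_1,\alpha_2)$ compatible with $(k^{(1)},k^{(2)})$ is obtained as follows: solve $$p_2\alpha_1^2+p_1\alpha_1+p_0=0,$$ retain every root $\alpha_1>0$, compute $$\alpha_2=-\frac{B_1\alpha_1+D_1}{A_1\alpha_1+C_1},$$ and retain the pair only if $$\alpha_2>0,\qquad\Delta_\ell(k^{(1)};\alpha_1,\alpha_2)=0,\qquad\Delta_\ell(k^{(2)};\alpha_1,\alpha_2)=0 .$$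
   Context: A physical impedance pair is a pair with $\alpha_1,\alpha_2>0$; it is compatible with $(k^{(1)},k^{(2)})$ if $\Delta_\ell(k^{(i)};\alpha_1,\alpha_2)=0$ for $i=1,2$. Resonant wavenumbers of mode $\ell$ are the positive zeros $k$ of $\Delta_\ell(\cdot;\alpha_1,\alpha_2)$. The condition $A_1\alpha_1+C_1\ne0$ is imposed at the value $\alpha_1$ of the pair under consideration. Let $\nu=d/2-1$, $\mu=\ell+\nu$, $L_i=\ell/R_i$, and $Z_{\mu,i}=Z_\mu(kR_i)$, $Z_{\mu+1,i}=Z_{\mu+1}(kR_i)$ for $Z\in\{J,Y\}$ (Bessel functions). Up to the irrelevant positive constant factor $R_1^{-\nu}R_2^{-\nu}$, the characteristic determinant is $$\Delta_\ell(k;\alpha_1,\alpha_2)=\mathrm A_\ell(k)\alpha_1\alpha_2+\mathrm B_\ell(k)\alpha_1+\mathrm C_\ell(k)\alpha_2+\mathrm D_\ell(k),$$ $$\mathrm A_\ell=J_{\mu,1}Y_{\mu,2}-J_{\mu,2}Y_{\mu,1},$$ $$\mathrm B_\ell=L_2\bigl(J_{\mu,1}Y_{\mu,2}-J_{\mu,2}Y_{\mu,1}\bigr)+k\bigl(J_{\mu+1,2}Y_{\mu,1}-J_{\mu,1}Y_{\mu+1,2}\bigr),$$ $$\mathrm C_\ell=-L_1\bigl(J_{\mu,1}Y_{\mu,2}-J_{\mu,2}Y_{\mu,1}\bigr)+k\bigl(J_{\mu+1,1}Y_{\mu,2}-J_{\mu,2}Y_{\mu+1,1}\bigr),$$ $$\mathrm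 D_\ell=\bigl(kJ_{\mu+1,1}-L_1J_{\mu,1}\bigr)\bigl(L_2Y_{\mu,2}-kY_{\mu+1,2}\bigr)-\bigl(L_2J_{\mu,2}-kJ_{\mu+1,2}\bigr)\bigl(kY_{\mu+1,1}-L_1Y_{\mu,1}\bigr).$$ Its positive zeros are the $k$ such that $k^2$ is an eigenvalue $\lambda$ of $u''+\frac{d-1}ru'+(\lambda-\frac{\ell(\ell+d-2)}{r^2})u=0$ on $(R_1,R_2)$ with $-u'(R_1)+\alpha_1u(R_1)=0$, $u'(R_2)+\alpha_2u(R_2)=0$. *)

(* Defs.v *)
From Stdlib Require Import Reals Factorial.
From Coquelicot Require Import Coquelicot.
Open Scope R_scope.

(** Bessel functions of real order.  The library has neither these nor the
    Gamma function, so we start from Gauss's product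
    [1/Gamma(s) = lim_n s (s+1) ... (s+n) / (n! n^s)], valid for every real [s]
    (it gives 0 at the poles of Gamma). *)
Fixpoint rising (s : R) (n : nat) : R :=
  match n with
  | O => 1
  | S m => rising s m * (s + INR m)
  end.

Definition rGamma (s : R) : R :=
  real (Lim_seq (fun n => rising s (S n) / (INR (fact n) * Rpower (INR n) s))).

(** [J_s(x) = (x/2)^s sum_m (-1)^m / (m! Gamma(s+m+1)) (x/2)^(2m)], meant for
    [0 < x] only: [Rpower] is the real power of a positive base. *)
Definition BesselJ (s x : R) : R :=
  Rpower (x / 2) s *
  PSeries (fun m => (-1) ^ m / INR (fact m) * rGamma (s + INR m + 1))
    ((x / 2) ^ 2).

Definition BesselY_quot (x s : R) : R :=
  (BesselJ s x * cos (s * PI) - BesselJ (- s) x) / sin (s * PI).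

(** At integer order, i.e. [sin (s * PI) = 0], the limit in the order. *)
Definition BesselY (s x : R) : R :=
  if Req_EM_T (sin (s * PI)) 0
  then real (Lim (BesselY_quot x) s)
  else BesselY_quot x s.

(** The shell is [r1 < |x| < r2] in dimension [d]; [l] is the angular mode. *)
Definition bessel_order (d l : nat) : R := INR l + (INR d / 2 - 1).

Definition charA (d l : nat) (r1 r2 k : R) : R :=
  let mu := bessel_order d l in
  BesselJ mu (k * r1) * BesselY mu (k * r2)
  - BesselJ mu (k * r2) * BesselY mu (k * r1).

Definition charB (d l : nat) (r1 r2 k : R) : R :=
  let mu := bessel_order d l in
  let L2 := INR l / r2 in
  L2 * (BesselJ mu (k * r1) * BesselY mu (k * r2)
        - BesselJ mu (k * r2) * BesselY mu (k * r1))
  + k * (BesselJ (mu + 1) (k * r2) * BesselY mu (k * r1)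
         - BesselJ mu (k * r1) * BesselY (mu + 1) (k * r2)).

Definition charC (d l : nat) (r1 r2 k : R) : R :=
  let mu := bessel_order d l in
  let L1 := INR l / r1 in
  - L1 * (BesselJ mu (k * r1) * BesselY mu (k * r2)
          - BesselJ mu (k * r2) * BesselY mu (k * r1))
  + k * (BesselJ (mu + 1) (k * r1) * BesselY mu (k * r2)
         - BesselJ mu (k * r2) * BesselY (mu + 1) (k * r1)).

Definition charD (d l : nat) (r1 r2 k : R) : R :=
  let mu := bessel_order d l in
  let L1 := INR l / r1 in
  let L2 := INR l / r2 in
  (k * BesselJ (mu + 1) (k * r1) - L1 * BesselJ mu (k * r1))
  * (L2 * BesselY mu (k * r2) - k * BesselY (mu + 1) (k * r2))
  - (L2 * BesselJ mu (k * r2) - k * BesselJ (mu + 1) (k * r2))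
    * (k * BesselY (mu + 1) (k * r1) - L1 * BesselY mu (k * r1)).

Definition charDet (d l : nat) (r1 r2 k alpha1 alpha2 : R) : R :=
  charA d l r1 r2 k * alpha1 * alpha2 + charB d l r1 r2 k * alpha1
  + charC d l r1 r2 k * alpha2 + charD d l r1 r2 k.

Definition resonant (d l : nat) (r1 r2 alpha1 alpha2 k : R) : Prop :=
  0 < k /\ charDet d l r1 r2 k alpha1 alpha2 = 0.

Definition physical (alpha1 alpha2 : R) : Prop := 0 < alpha1 /\ 0 < alpha2.

Definition compatible (d l : nat) (r1 r2 k1 k2 alpha1 alpha2 : R) : Prop :=
  charDet d l r1 r2 k1 alpha1 alpha2 = 0 /\ charDet d l r1 r2 k2 alpha1 alpha2 = 0.

(* Main.v *)
(** Each determinant is affine in [alpha2], namely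
    [(A_i alpha1 + C_i) alpha2 + (B_i alpha1 + D_i)], and eliminating [alpha2]
    between the two leaves the quadratic as their resultant. *)
Require Import Defs.
From Stdlib Require Import Reals Lra.
Open Scope R_scope.

(** A compatible pair makes two equations affine in [alpha2] vanish together, so their resultant,
    the quadratic in [alpha1], vanishes. Since [A1 * alpha1 + C1] is nonzero, the first equation
    then determines [alpha2]. Conversely, the retention tests contain positivity and
    compatibility. *)

Theorem proposition4p2 (d l : nat) (hd : (2 <= d)%nat)
  (r1 r2 : R) (hr1 : 0 < r1) (hr12 : r1 < r2)
  (k1 k2 : R) (hk : k1 <> k2)
  (hres : exists beta1 beta2 : R,
      resonant d l r1 r2 beta1 beta2 k1 /\ resonant d l r1 r2 beta1 beta2 k2) :
  let A1 := charA d l r1 r2 k1 in let A2 := charA d l r1 r2 k2 in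
  let B1 := charB d l r1 r2 k1 in let B2 := charB d l r1 r2 k2 in
  let C1 := charC d l r1 r2 k1 in let C2 := charC d l r1 r2 k2 in
  let D1 := charD d l r1 r2 k1 in let D2 := charD d l r1 r2 k2 in
  let p0 := C1 * D2 - C2 * D1 in
  let p1 := A1 * D2 - A2 * D1 + B2 * C1 - B1 * C2 in
  let p2 := A1 * B2 - A2 * B1 in
  p2 ^ 2 + p1 ^ 2 + p0 ^ 2 <> 0 ->
  forall alpha1 alpha2 : R,
  A1 * alpha1 + C1 <> 0 ->
  (physical alpha1 alpha2 /\ compatible d l r1 r2 k1 k2 alpha1 alpha2) <->
  (p2 * alpha1 ^ 2 + p1 * alpha1 + p0 = 0 /\ 0 < alpha1 /\
   alpha2 = - ((B1 * alpha1 + D1) / (A1 * alpha1 + C1)) /\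
   0 < alpha2 /\
   charDet d l r1 r2 k1 alpha1 alpha2 = 0 /\
   charDet d l r1 r2 k2 alpha1 alpha2 = 0).
Proof.
  intros A1 A2 B1 B2 C1 C2 D1 D2 p0 p1 p2 _ alpha1 alpha2 hM.
  split.
  - intros [[ha1 ha2] [E1 E2]].
    repeat split; try assumption.
    (* Cross-multiplying by the coefficients of [alpha2] cancels [alpha2] identically, so the
       quadratic is a combination of the two determinants. *)
    + replace (p2 * alpha1 ^ 2 + p1 * alpha1 + p0)
        with ((A1 * alpha1 + C1) * charDet d l r1 r2 k2 alpha1 alpha2
              - (A2 * alpha1 + C2) * charDet d l r1 r2 k1 alpha1 alpha2)
        by (unfold p0, p1, p2, charDet; fold A1 A2 B1 B2 C1 C2 D1 D2; ring).
      rewrite E1, E2; ring.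
    + unfold charDet in E1; fold A1 B1 C1 D1 in E1.
      (* Clearing the nonzero denominator leaves the first determinant equation. *)
      apply Rmult_eq_reg_r with (A1 * alpha1 + C1); [| exact hM].
      replace (- ((B1 * alpha1 + D1) / (A1 * alpha1 + C1)) * (A1 * alpha1 + C1))
        with (- (B1 * alpha1 + D1)) by (field; exact hM).
      lra.
  - intros (_ & ha1 & _ & ha2 & E1 & E2).
    repeat split; assumption.
Qed.
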